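(* Let $f_1,\dots,f_N:\mathcal{X}\to\mathbb{R}$ be such that each $f_i$ is strictly convex, continuously differentiable, and has a minimizer $x_i^*\in\mathcal{X}$. Let $(u(k))_{k=1}^\infty$ be a sequence of gossiping pairs such that the graph $(\mathcal{V},\mathcal{E}_\infty)$ is connected, and let $\mathbf{x}(k)=(\hat{x}_1(k),\dots,\hat{x}_N(k))$, $k\in\mathbb{N}$, be the sequence of estimates generated by Pairwise Equalizing (PE) along $(u(k))_{k=1}^\infty$. Then $$\lim_{k\to\infty}V(\mathbf{x}(k))=0\qquad\text{and}\qquad \lim_{k\to\infty}\hat{x}_i(k)=x^*\quad\forall i\in\mathcal{V}.$$
   Context: Let $N\ge 2$, $\mathcal{V}=\{1,2,\dots,N\}$, $\mathbb{N}=\{0,1,2,\dots\}$, $\mathbb{P}=\{1,2,\dots\}$, and let $\mathcal{X}\subset\mathbb{R}$ be a nonempty open interval. For each time $k$ the network is an undirected graph $(\mathcal{V},\mathcal{E}(k))$, where $\mathcal{E}(k)\subset\{\{i,j\}:i,j\in\mathcal{V},i\ne j\}$ is nonempty. A sequence of gossiping pairs is a sequence $(u(k))_{k=1}^\infty$ with $u(k)=\{u_1(k),u_2(k)\}\in\mathcal{E}(k)$ a pair of distinct nodes for every $k\in\mathbb{P}$ (the topology is arbitrary and time-varying, so $u(k)$ may be any pair of distinct nodes). Define $\mathcal{E}_\infty=\{\{i,j\}: u(k)=\{i,j\}\text{ for infinitely many }k\in\mathbb{P}\}$. Let $F(x)=\sum_{i\in\mathcal{V}}f_i(x)$ for $x\in\mathcal{X}$,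 and let $x^*$ denote the unique minimizer of $F$ over $\mathcal{X}$ (it exists under the stated assumptions on the $f_i$). Derivatives are denoted $f_i'$. Pairwise Equalizing (PE): the estimates are initialized by $\hat{x}_i(0)=x_i^*$ for all $i\in\mathcal{V}$, and for every $k\in\mathbb{P}$ and $i\in\mathcal{V}$, $$\hat{x}_i(k)=\begin{cases}\bigl(\sum_{j\in u(k)}f_j'\bigr)^{-1}\bigl(\sum_{j\in u(k)}f_j'(\hat{x}_j(k-1))\bigr), & i\in u(k),\\ \hat{x}_i(k-1), & \text{otherwise,}\end{cases}$$ where $(\sum_{j\in u(k)}f_j')^{-1}$ is the inverse of the injective function $\sum_{j\in u(k)}f_j':\mathcal{X}\to\mathbb{R}$ with codomain restricted to its range (the update is always well-defined). The function $V:\mathcal{X}^N\to\mathbb{R}$ is $$V(x_1,\dots,x_N)=\sum_{i\in\mathcal{V}}\Bigl(f_i(x^* )-f_i(x_i)-f_i'(x_i)(x^*-x_i)\Bigr).$$ *)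

(* Defs.v *)
From HB Require Import structures.
From mathcomp Require Import all_boot all_order all_algebra.
From mathcomp Require Import all_classical all_reals all_analysis.

Set Implicit Arguments.
Unset Strict Implicit.
Unset Printing Implicit Defensive.

Import Order.TTheory GRing.Theory Num.Theory.
Import numFieldNormedType.Exports.

Local Open Scope classical_set_scope.
Local Open Scope ring_scope.

(* A function g : X -> R on an open interval X is represented by a total
   function R -> R of which only the values on X are used; since X is open,
   derivatives at points of X do not depend on the values outside X. *)

Definition strictly_convex_on (R : realType) (X : set R) (g : R -> R) : Prop :=
  forall x y t : R, X x -> X y -> x != y -> 0 < t < 1 ->
    g (t * x + (1 - t) * y) < t * g x + (1 - t) * g y.

Definition continuously_differentiable_on (R : realType) (X : set R)
    (g : R -> R) : Prop :=
  (forall x, X x -> derivable g x 1) /\ {within X, continuous (derive1 g)}.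

Definition minimizers (R : realType) (X : set R) (g : R -> R) : set R :=
  [set x | X x /\ forall y, X y -> g x <= g y].

(* Meaningful when g has a minimizer over X (the value is 0 otherwise). *)
Definition argmin (R : realType) (X : set R) (g : R -> R) : R :=
  xget 0 (minimizers X g).

(* The nodes 1, ..., N are the elements of 'I_N; an undirected edge {i, j} is
   a two-element {set 'I_N}. *)
Definition edge_set (N : nat) (E : {set {set 'I_N}}) : Prop :=
  E != finset.set0 /\ forall e, e \in E -> #|e| = 2%N.

(* Only the times k >= 1 matter: u 0 and E 0 are unused. *)
Definition gossiping_pairs (N : nat) (E : nat -> {set {set 'I_N}})
    (u : nat -> {set 'I_N}) : Prop :=
  forall k, (1 <= k)%N -> u k \in E k.

Definition edges_infty (N : nat) (u : nat -> {set 'I_N}) : set {set 'I_N} :=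
  [set e | infinite_set [set k : nat | (1 <= k)%N /\ u k = e]].

Definition connected_graph (N : nat) (E : set {set 'I_N}) : Prop :=
  forall i j : 'I_N,
    connect [rel a b : 'I_N | [set a; b]%SET \in E] i j.

Definition total_objective (R : realType) (N : nat) (f : 'I_N -> R -> R) :
    R -> R :=
  fun x => \sum_(i < N) f i x.

(* 'pinv_(fun=> 0) X h is the inverse of h : X -> h @` X: on the range h @` X
   it selects a preimage in X (unique when h is injective on X), and it is 0
   off that range. *)
Fixpoint PE (R : realType) (X : set R) (N : nat) (f : 'I_N -> R -> R)
    (u : nat -> {set 'I_N}) (k : nat) : 'I_N -> R :=
  match k with
  | 0%N => fun i => argmin X (f i)
  | k'.+1 => fun i =>
      if i \in u k'.+1 then
        'pinv_(fun=> 0) X (fun z => \sum_(j in u k'.+1) derive1 (f j) z)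
          (\sum_(j in u k'.+1) derive1 (f j) (PE X f u k' j))
      else PE X f u k' i
  end.

Definition V (R : realType) (X : set R) (N : nat) (f : 'I_N -> R -> R)
    (x : 'I_N -> R) : R :=
  let xstar := argmin X (total_objective f) in
  \sum_(i < N) (f i xstar - f i (x i) - derive1 (f i) (x i) * (xstar - x i)).

(* Main.v *)
Require Import Defs.
From HB Require Import structures.
From mathcomp Require Import all_boot all_order all_algebra.
From mathcomp Require Import all_classical all_reals all_analysis.
From mathcomp Require Import lra ring.

Set Implicit Arguments.
Unset Strict Implicit.
Unset Printing Implicit Defensive.

Import Order.TTheory GRing.Theory Num.Theory.
Import numFieldNormedType.Exports.

Local Open Scope classical_set_scope.
Local Open Scope ring_scope.

(** Write [g i] for the derivative of [f i]: it is continuous and strictly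
    increasing on [X], and an update replaces the estimates in a group of nodes
    by the common value that preserves the sum of the [g i].  That value lies
    between the extreme estimates of the group ([common_value_ge],
    [common_value_le]), so an interval containing all the estimates contains
    them forever, and the total [\sum_i g i (x i)] keeps its initial value,
    which is 0.

    Convergence comes from a family of Lyapunov functions, one for each level
    [c] of [X]: the [excess] over [c], that is the sum of the positive parts of
    [g i (x i) - g i c].  No update increases it ([excess_decrease]), and an
    update of two nodes lying on opposite sides of [c] cancels a positive part
    against a negative one.  If [p < c < q], [x i <= p] and [q <= x j], the loss
    is bounded below by a constant, so updates that straddle [[p, q]] occur
    finitely often ([straddles_eventually_stop]).

    Suppose that at all times some estimate is at most [a] and some estimate is
    at least [b], with [a < b].  Cut [[a, b]] into one more gap than there are
    nodes.  After some time no update straddles any of these gaps, and at that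
    time one of them contains no estimate.  From then on the nodes below this
    gap and those above it never meet, which contradicts the connectivity of
    the graph of recurrent edges ([no_persistent_spread]).

    Let [L] be the point where [\sum_i g i L = 0].  The conserved total forces
    an estimate on each side of [L] at every time, so the previous paragraph,
    applied to [L] and any other point of [X], brings all the estimates
    eventually as close to [L] as desired ([equalizing_cvg]).  By strict
    convexity [L] is the unique minimizer of the sum of the [f i]
    ([argmin_total_objective]), and [V] tends to 0 because the [f i] and the
    [g i] are continuous at [L]. *)

(** * Differentiable strictly convex functions on an open interval *)

Lemma is_interval_mid (R : realType) (X : set R) (x y : R) :
  is_interval X -> X x -> X y -> X ((x + y) / 2).
Proof.
move=> Xi Xx Xy; have [xy|/ltW yx] := leP x y.
  by apply: (Xi x y) => //; apply/andP; split; lra.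
by apply: (Xi y x) => //; apply/andP; split; lra.
Qed.

(** On the segment from [x] to [y] the difference quotients of [f] at [x] stay
    below [f y - f x]; their limit is the slope in the direction [y - x]. *)
Lemma convex_ge_tangent (R : realType) (X : set R) (f : R -> R) (x y : R) :
    strictly_convex_on X f -> derivable f x 1 -> X x -> X y ->
  f x + derive1 f x * (y - x) <= f y.
Proof.
move=> cf df Xx Xy; have [->|xy] := eqVneq x y; first by rewrite subrr; lra.
have dfx : differentiable f x by apply/derivable1_diffP.
have -> : derive1 f x * (y - x) = 'D_(y - x) f x.
  by rewrite derive1E' // deriveE // -{2}[y - x]mulr1 [in RHS]linearZ/= mulrC.
rewrite addrC -lerBrDr.
have dfv : derivable f x (y - x) by exact: diff_derivable.
apply: (@cvgr_to_le R^o (0 : R)^'+ _ R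
  (fun h => h^-1 *: (f (h *: (y - x) + x) - f x))).
  exact: cvg_dnbhs_at_right dfv.
near=> h.
have h0 : 0 < h by near: h; exact: nbhs_right_gt.
have h1 : h < 1 by near: h; exact: nbhs_right_lt.
have h01 : 0 < h < 1 by rewrite h0.
have yx : y != x by rewrite eq_sym.
have := cf y x h Xy Xx yx h01.
have -> : h * y + (1 - h) * x = h *: (y - x) + x.
  by rewrite /GRing.scale/=; ring.
rewrite /GRing.scale/= => H.
by rewrite mulrC ler_pdivrMr //; lra.
Unshelve. all: by end_near. Qed.

(** The weak inequality at the midpoint of [x] and [y], combined with strict
    convexity there, upgrades to a strict one at [y]. *)
Lemma strictly_convex_gt_tangent (R : realType) (X : set R) (f : R -> R)
    (x y : R) :
    is_interval X -> strictly_convex_on X f -> derivable f x 1 ->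
    X x -> X y -> x != y ->
  f x + derive1 f x * (y - x) < f y.
Proof.
move=> Xi cf df Xx Xy xy.
have Xm := is_interval_mid Xi Xx Xy.
have := convex_ge_tangent cf df Xx Xm.
have h12 : 0 < (2^-1 : R) < 1 by apply/andP; split; lra.
have := cf x y 2^-1 Xx Xy xy h12.
have -> : 2^-1 * x + (1 - 2^-1) * y = (x + y) / 2 by lra.
have -> : derive1 f x * ((x + y) / 2 - x) = derive1 f x * (y - x) / 2 by lra.
lra.
Qed.

(** Add the tangent inequalities at [x] and at [y]. *)
Lemma strictly_convex_derive1_lt (R : realType) (X : set R) (f : R -> R)
    (x y : R) :
    is_interval X -> strictly_convex_on X f ->
    (forall z, X z -> derivable f z 1) -> X x -> X y -> x < y ->
  derive1 f x < derive1 f y.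
Proof.
move=> Xi cf df Xx Xy xy.
have nxy : x != y by rewrite lt_eqF.
have nyx : y != x by rewrite gt_eqF.
have Hx := strictly_convex_gt_tangent Xi cf (df _ Xx) Xx Xy nxy.
have Hy := strictly_convex_gt_tangent Xi cf (df _ Xy) Xy Xx nyx.
have : 0 < (derive1 f y - derive1 f x) * (y - x) by lra.
by rewrite pmulr_lgt0 ?subr_gt0.
Qed.

Lemma derive1_minimizer (R : realType) (X : set R) (f : R -> R) (x : R) :
    open X -> (forall z, X z -> derivable f z 1) -> minimizers X f x ->
  derive1 f x = 0.
Proof.
move=> Xo df [Xx fmin].
have [e /= e0 eX] : nbhs_ball x X by apply/nbhs_ballP; exact: open_nbhs_nbhs.
have XI t : t \in `]x - e, x + e[ -> X t.
  rewrite in_itv/= => /andP[? ?]; apply: eX.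
  by rewrite /ball/= ltr_distlC; apply/andP; split; lra.
rewrite derive1E.
apply: (@derive_val _ _ _ _ _ _ _ (derive1_at_min (a := x - e) (b := x + e) _ _ _ _)).
- lra.
- by move=> t /XI /df.
- by rewrite in_itv/=; apply/andP; split; lra.
- by move=> t /XI /fmin.
Qed.

(** * Networks of increasing functions with equalizing steps *)

(** Replacing the positive part of each term by the positive part of the sum
    loses the smaller of the total positive and the total negative part. *)
Lemma sum_max0_le (R : realDomainType) (I : finType) (S : {set I})
    (w : I -> R) (e : R) :
    e <= \sum_(i in S) Num.max 0 (w i) ->
    e <= \sum_(i in S) Num.max 0 (- w i) ->
  Num.max 0 (\sum_(i in S) w i) + e <= \sum_(i in S) Num.max 0 (w i).
Proof.
move=> epos eneg; rewrite -lerBrDr ge_max; apply/andP; split; first lra.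
have : \sum_(i in S) Num.max 0 (w i) =
    \sum_(i in S) w i + \sum_(i in S) Num.max 0 (- w i).
  rewrite -big_split/=; apply: eq_bigr => i _.
  by case: (leP 0 (w i)); case: (leP 0 (- w i)); lra.
lra.
Qed.

Lemma term_le_sum (R : realDomainType) (I : finType) (S : {set I})
    (w : I -> R) (i : I) :
  (forall j, 0 <= w j) -> i \in S -> w i <= \sum_(j in S) w j.
Proof.
by move=> w0 iS; rewrite (bigD1 i)//= lerDl; apply: sumr_ge0.
Qed.

(** A nonincreasing sequence bounded below converges, so its successive drops
    tend to 0. *)
Lemma finitely_many_drops (R : realType) (phi : nat -> R) (P : nat -> Prop)
    (e : R) :
    0 < e -> (forall k, 0 <= phi k) -> (forall k, phi k.+1 <= phi k) ->
    (forall k, P k -> phi k.+1 + e <= phi k) ->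
  \forall k \near \oo, ~ P k.
Proof.
move=> e0 phi0 dec drop.
have cphi : cvgn phi.
  apply: nonincreasing_is_cvgn; first exact/nonincreasing_seqP.
  by exists 0 => _ [k _ <-].
have diff0 : phi k - phi k.+1 @[k --> \oo] --> (0 : R).
  rewrite -(subrr (limn phi)); apply: cvgB => //.
  by have := cphi; rewrite -(cvg_shiftS phi).
near=> k => /drop.
have : phi k - phi k.+1 < e by near: k; exact: (cvgr_lt (0 : R)).
lra.
Unshelve. all: by end_near. Qed.

Section Equalizing.
Variables (R : realType) (I : finType) (X : set R) (g : I -> R -> R).
Hypothesis Xitv : is_interval X.
Hypothesis g_lt : forall i x y, X x -> X y -> x < y -> g i x < g i y.

Let g_le i x y : X x -> X y -> x <= y -> g i x <= g i y.
Proof.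
by move=> Xx Xy; rewrite le_eqVlt => /predU1P[->//|/(g_lt i Xx Xy)/ltW].
Qed.

Let sum_g_lt (S : {set I}) (x y : I -> R) (i0 : I) :
    i0 \in S -> (forall i, X (x i)) -> (forall i, X (y i)) ->
    (forall i, i \in S -> x i < y i) ->
  \sum_(i in S) g i (x i) < \sum_(i in S) g i (y i).
Proof.
move=> i0S Xx Xy xy; rewrite (bigD1 i0)//= [ltRHS](bigD1 i0)//=.
apply: ltr_leD; first by apply: g_lt => //; exact: xy.
by apply: ler_sum => i /andP[iS _]; apply: g_le => //; apply/ltW/xy.
Qed.

Lemma common_value_ge (S : {set I}) (x : I -> R) (z : R) (i0 : I) :
    i0 \in S -> X z -> (forall i, X (x i)) ->
    \sum_(i in S) g i z = \sum_(i in S) g i (x i) ->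
  exists2 i, i \in S & x i <= z.
Proof.
move=> i0S Xz Xx sumE; apply: contrapT => noi.
suff : \sum_(i in S) g i z < \sum_(i in S) g i (x i) by rewrite sumE ltxx.
apply: (sum_g_lt (x := fun=> z) i0S) => // i iS.
by rewrite ltNge; apply/negP => xz; apply: noi; exists i.
Qed.

Lemma common_value_le (S : {set I}) (x : I -> R) (z : R) (i0 : I) :
    i0 \in S -> X z -> (forall i, X (x i)) ->
    \sum_(i in S) g i z = \sum_(i in S) g i (x i) ->
  exists2 i, i \in S & z <= x i.
Proof.
move=> i0S Xz Xx sumE; apply: contrapT => noi.
suff : \sum_(i in S) g i (x i) < \sum_(i in S) g i z by rewrite sumE ltxx.
apply: (sum_g_lt (y := fun=> z) i0S) => // i iS.
by rewrite ltNge; apply/negP => xz; apply: noi; exists i.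
Qed.

(** Intermediate value theorem between the least and the greatest [x i]. *)
Lemma common_value_exists (S : {set I}) (x : I -> R) (i0 : I) :
    i0 \in S -> (forall i, X (x i)) ->
    (forall i z, X z -> {for z, continuous (g i)}) ->
  exists2 z, X z & \sum_(i in S) g i z = \sum_(i in S) g i (x i).
Proof.
move=> i0S Xx gc.
have [i _ imin] := @arg_minP _ _ I i0 [in S] x i0S.
have [j _ jmax] := @arg_maxP _ _ I i0 [in S] x i0S.
have xij : x i <= x j by apply: le_trans (imin _ i0S) (jmax _ i0S).
have Xij z : z \in `[x i, x j] -> X z.
  by rewrite in_itv/= => zij; exact: Xitv zij.
have lo : \sum_(k in S) g k (x i) <= \sum_(k in S) g k (x k).
  by apply: ler_sum => k kS; apply: g_le => //; exact: imin.
have hi : \sum_(k in S) g k (x k) <= \sum_(k in S) g k (x j).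
  by apply: ler_sum => k kS; apply: g_le => //; exact: jmax.
have [||z zij zE] := @IVT _ (fun z => \sum_(k in S) g k z) (x i) (x j)
    (\sum_(k in S) g k (x k)) xij.
- apply: continuous_in_subspaceT => z /set_mem /Xij Xz.
  apply: cvg_big => [|k kS]; last exact: gc.
  exact: add_continuous.
- by rewrite ge_min lo/= le_max hi orbT.
- by exists z => //; exact: Xij.
Qed.

(** An update, as a relation: the common value is determined by monotonicity of
    the [g i], so no inverse function has to be mentioned. *)
Definition equalizes (S : {set I}) (x y : I -> R) : Prop :=
  (forall i, i \notin S -> y i = x i) /\
  exists z, [/\ X z, forall i, i \in S -> y i = z &
    \sum_(i in S) g i z = \sum_(i in S) g i (x i)].

Lemma equalizes_sum S x y :
  equalizes S x y -> \sum_i g i (y i) = \sum_i g i (x i).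
Proof.
move=> [yN [z [_ yS sumE]]].
rewrite (bigID [in S])//= [RHS](bigID [in S])//=; congr (_ + _).
  by rewrite -sumE; apply: eq_bigr => i /yS ->.
by apply: eq_bigr => i /yN ->.
Qed.

Lemma equalizes_in S x y :
  (forall i, X (x i)) -> equalizes S x y -> forall i, X (y i).
Proof.
move=> Xx [yN [z [Xz yS _]]] i.
by have [/yS ->|/yN ->] := boolP (i \in S).
Qed.

(** Upper bounds persist.  The condition on [j] selects the nodes whose estimate
    can influence the new value at [i]: [i] itself, and all of [S] when [i] is
    in [S].  This is what confines the two sides of a gap separately. *)
Lemma equalizes_le S x y c i :
    (forall i, X (x i)) -> equalizes S x y ->
    (forall j, j = i \/ i \in S /\ j \in S -> x j <= c) ->
  y i <= c.
Proof.
move=> Xx [yN [z [Xz yS sumE]]] xc.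
have [iS|iS] := boolP (i \in S); last by rewrite yN//; apply: xc; left.
rewrite yS//; have [j jS zx] := common_value_le iS Xz Xx sumE.
by apply: le_trans zx _; apply: xc; right.
Qed.

Lemma equalizes_ge S x y c i :
    (forall i, X (x i)) -> equalizes S x y ->
    (forall j, j = i \/ i \in S /\ j \in S -> c <= x j) ->
  c <= y i.
Proof.
move=> Xx [yN [z [Xz yS sumE]]] xc.
have [iS|iS] := boolP (i \in S); last by rewrite yN//; apply: xc; left.
rewrite yS//; have [j jS zx] := common_value_ge iS Xz Xx sumE.
by apply: le_trans zx; apply: xc; right.
Qed.

Definition excess (c : R) (x : I -> R) : R :=
  \sum_i Num.max 0 (g i (x i) - g i c).

(** After the update, the terms [g i z - g i c] over [S] all have the same sign,
    so the sum of their positive parts is the positive part of their sum, and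
    that sum has not changed. *)
Lemma excess_decrease (S : {set I}) (x y : I -> R) (c e : R) :
    X c -> (forall i, X (x i)) -> equalizes S x y ->
    e <= \sum_(i in S) Num.max 0 (g i (x i) - g i c) ->
    e <= \sum_(i in S) Num.max 0 (- (g i (x i) - g i c)) ->
  excess c y + e <= excess c x.
Proof.
move=> Xc Xx [yN [z [Xz yS sumE]]] epos eneg.
rewrite /excess (bigID [in S])//= [leRHS](bigID [in S])//= addrAC.
apply: lerD; last by apply: ler_sum => i /yN ->.
apply: le_trans (sum_max0_le epos eneg); rewrite lerD2r.
rewrite big_split/= sumrN -sumE -sumrN -big_split/=.
rewrite (eq_bigr (fun i => Num.max 0 (g i z - g i c))); last first.
  by move=> i /yS ->.
have [cz|/ltW zc] := leP c z.
  rewrite le_max; apply/orP; right; apply: ler_sum => i _.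
  by rewrite ge_max lexx andbT subr_ge0 g_le.
rewrite le_max big1 ?lexx// => i _; apply/max_idPl.
by rewrite subr_le0 g_le.
Qed.

Variables (u : nat -> {set I}) (x : nat -> I -> R).
Hypothesis x0_in : forall i, X (x 0%N i).
Hypothesis x_step : forall k, equalizes (u k.+1) (x k) (x k.+1).

Let Xx k i : X (x k i).
Proof. by elim: k i => // k IH; exact: equalizes_in IH (x_step k). Qed.

Lemma equalizing_sum k : \sum_i g i (x k i) = \sum_i g i (x 0%N i).
Proof. by elim: k => // k <-; exact: equalizes_sum (x_step k). Qed.

(** For a fixed pair of nodes, such an update lowers the excess over the midpoint
    [c] by at least the constant [e] of the proof. *)
Lemma straddles_eventually_stop (p q : R) :
    X p -> X q -> p < q ->
  \forall k \near \oo, forall i j, i \in u k.+1 -> j \in u k.+1 ->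
    x k i <= p -> q <= x k j -> False.
Proof.
move=> Xp Xq pq.
set c := (p + q) / 2.
have Xc : X c := is_interval_mid Xitv Xp Xq.
have pc : p < c by rewrite /c; lra.
have cq : c < q by rewrite /c; lra.
suff H (ij : I * I) : \forall k \near \oo,
    ~ [/\ ij.1 \in u k.+1, ij.2 \in u k.+1, x k ij.1 <= p & q <= x k ij.2].
  have [K _ HK] := filter_forall _ H.
  by exists K => // k /HK Hk i j iu ju xp xq; exact: (Hk (i, j) (And4 iu ju xp xq)).
case: ij => i j /=.
pose e := Num.min (g j q - g j c) (g i c - g i p).
apply: (@finitely_many_drops _ (fun k => excess c (x k)) _ e).
- by rewrite lt_min !subr_gt0 !g_lt.
- by move=> k; apply: sumr_ge0 => l _; rewrite le_max lexx.
- move=> k; rewrite -[leLHS]addr0.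
  by apply: excess_decrease (x_step k) _ _ => //; apply: sumr_ge0 => l _;
    rewrite le_max lexx.
- move=> k [iu ju xp xq]; apply: excess_decrease (x_step k) _ _ => //.
    apply: (le_trans _ (term_le_sum (i := j) _ ju)); last first.
      by move=> l; rewrite le_max lexx.
    by rewrite le_max; apply/orP; right; rewrite ge_min lerD2r g_le.
  apply: (le_trans _ (term_le_sum (i := i) _ iu)); last first.
    by move=> l; rewrite le_max lexx.
  by rewrite le_max opprB; apply/orP; right; rewrite ge_min lerD2l lerN2 g_le// orbT.
Qed.

(** Connectivity in the form in which it is used: nodes on the two sides of any
    cut meet at arbitrarily late times. *)
Hypothesis cut_crossed : forall (A : {set I}) a b, a \in A -> b \notin A ->
  forall K, exists2 k, (K <= k)%N &
    exists i j, [/\ i \in A, j \notin A, i \in u k.+1 & j \in u k.+1].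

(** Pigeonhole: there is one more gap than there are nodes. *)
Lemma empty_gap (a b : R) (y : I -> R) :
    a < b ->
  exists l : 'I_#|I|.+1, forall i,
    y i <= a + (b - a) * l%:R / #|I|.+1%:R \/
    a + (b - a) * l.+1%:R / #|I|.+1%:R <= y i.
Proof.
move=> ab; apply: contrapT => noempty.
pose p (l : nat) := a + (b - a) * l%:R / #|I|.+1%:R.
have p_mono l m : (l <= m)%N -> p l <= p m.
  move=> lm; rewrite /p lerD2l ler_wpM2r ?invr_ge0//.
  by rewrite ler_wpM2l ?ler_nat// subr_ge0 ltW.
have /choice[s sP] (l : 'I_#|I|.+1) : exists i, p l < y i < p l.+1.
  apply: contrapT => noi; apply: noempty; exists l => i.
  have [yp|py] := leP (y i) (p l); first by left.
  have [py'|yp'] := leP (p l.+1) (y i); first by right.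
  by case: noi; exists i; rewrite py.
have s_inj : injective s.
  move=> l m slm; apply/val_inj/eqP; rewrite eqn_leq.
  have /andP[l1 l2] := sP l; have /andP[m1 m2] := sP m.
  rewrite slm in l1 l2.
  by apply/andP; split; rewrite leqNgt; apply/negP => /p_mono; lra.
by have := leq_card s s_inj; rewrite card_ord ltnn.
Qed.

(** The nodes below and above a gap that is empty once straddles have stopped
    stay on their sides ([sides]) and never meet again. *)
Lemma no_persistent_spread (a b : R) :
    X a -> X b -> a < b ->
    (forall k, exists i, x k i <= a) -> (forall k, exists j, b <= x k j) ->
  False.
Proof.
move=> Xa Xb ab lo hi.
pose p (l : nat) := a + (b - a) * l%:R / #|I|.+1%:R.
have p_ltS l : p l < p l.+1.
  by rewrite /p ltrD2l -!mulrA ltr_pM2l ?subr_gt0// ltr_pM2r ?invr_gt0// ltr_nat.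
have p_itv (l : nat) : (l <= #|I|.+1)%N -> a <= p l <= b.
  move=> ln; apply/andP; split.
    by rewrite /p lerDl divr_ge0// mulr_ge0// subr_ge0 ltW.
  rewrite /p -lerBrDl -mulrA ler_piMr//; first by rewrite subr_ge0 ltW.
  by rewrite ler_pdivrMr// mul1r ler_nat.
have Xp (l : nat) : (l <= #|I|.+1)%N -> X (p l).
  by move=> /p_itv; exact: Xitv.
have [K _ stop] : \forall k \near \oo, forall l : 'I_#|I|.+1,
    forall i j, i \in u k.+1 -> j \in u k.+1 ->
      x k i <= p l -> p l.+1 <= x k j -> False.
  apply: filter_forall => l; apply: straddles_eventually_stop => //.
    by apply: Xp; exact: ltnW.
  exact: Xp.
have [l gap] := empty_gap (x K) ab; rewrite -/(p _) -/(p _) in gap.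
pose A := [set i | x K i <= p l]%SET.
have sides k : (K <= k)%N -> forall i,
    (i \in A -> x k i <= p l) /\ (i \notin A -> p l.+1 <= x k i).
  elim: k => [|k IH].
    rewrite leqn0 => /eqP K0 i; rewrite !inE -K0; split=> //.
    by move=> /negP xi; case: (gap i).
  rewrite leq_eqVlt => /predU1P[KE|Kk] i.
    rewrite !inE -KE; split=> //.
    by move=> /negP xi; case: (gap i).
  have {}IH := IH Kk; have stopk := stop k Kk l.
  split=> iA.
    apply: (equalizes_le (Xx k) (x_step k)) => j [->|[iu ju]].
      exact: (IH i).1.
    apply: (IH j).1; apply/negPn/negP => jA.
    exact: stopk i j iu ju ((IH i).1 iA) ((IH j).2 jA).
  apply: (equalizes_ge (Xx k) (x_step k)) => j [->|[iu ju]].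
    exact: (IH i).2.
  apply: (IH j).2; apply/negP => jA.
  exact: stopk j i ju iu ((IH j).1 jA) ((IH i).2 iA).
have [i xi] := lo K; have [j xj] := hi K.
have iA : i \in A.
  rewrite inE (le_trans xi)//; have /andP[] := p_itv l (ltnW (ltn_ord l)).
  by [].
have jA : j \notin A.
  rewrite inE -ltNge (lt_le_trans (p_ltS l))// (le_trans _ xj)//.
  by have /andP[] := p_itv l.+1 (ltn_ord l).
have [k Kk [i' [j' [i'A j'A iu ju]]]] := cut_crossed iA jA K.
exact: stop k Kk l i' j' iu ju ((sides k Kk i').1 i'A)
  ((sides k Kk j').2 j'A).
Qed.

Variable L : R.
Hypothesis X_open : open X.
Hypothesis XL : X L.
Hypothesis L_balance : \sum_i g i L = \sum_i g i (x 0%N i).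

Let sumL k : \sum_(i in [set: I]%SET) g i L = \sum_(i in [set: I]%SET) g i (x k i).
Proof.
have inT i : (i \in [set: I]%SET) = true by rewrite inE.
by rewrite !(eq_bigl _ _ inT) L_balance equalizing_sum.
Qed.

(* If [c] is never an upper bound, then some estimate is above [c] at all times,
   while balance at [L] leaves some estimate at or below [L]. *)
Let eventually_lt (c : R) :
  X c -> L < c -> \forall k \near \oo, forall i, x k i <= c.
Proof.
move=> Xc Lc.
have [[K xK]|spread] := pselect (exists K, forall i, x K i <= c).
  exists K => // k; elim: k => [|k IH] /=; first by rewrite leqn0 => /eqP <-.
  rewrite leq_eqVlt => /predU1P[<-//|/IH xk] i.
  exact: equalizes_le (Xx k) (x_step k) _.
near=> k => i; exfalso; apply: (no_persistent_spread XL Xc Lc) => m.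
  have [|j _ ?] := common_value_ge (i0 := i) _ XL (Xx m) (sumL m).
    by rewrite inE.
  by exists j.
apply: contrapT => noj; apply: spread; exists m => j.
by have [//|/ltW cx] := leP (x m j) c; case: noj; exists j.
Unshelve. all: by end_near. Qed.

Let eventually_gt (c : R) :
  X c -> c < L -> \forall k \near \oo, forall i, c <= x k i.
Proof.
move=> Xc Lc.
have [[K xK]|spread] := pselect (exists K, forall i, c <= x K i).
  exists K => // k; elim: k => [|k IH] /=; first by rewrite leqn0 => /eqP <-.
  rewrite leq_eqVlt => /predU1P[<-//|/IH xk] i.
  exact: equalizes_ge (Xx k) (x_step k) _.
near=> k => i; exfalso; apply: (no_persistent_spread Xc XL Lc) => m.
  apply: contrapT => noj; apply: spread; exists m => j.
  by have [//|/ltW cx] := leP c (x m j); case: noj; exists j.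
have [|j _ ?] := common_value_le (i0 := i) _ XL (Xx m) (sumL m).
  by rewrite inE.
by exists j.
Unshelve. all: by end_near. Qed.

Theorem equalizing_cvg i : x k i @[k --> \oo] --> L.
Proof.
have [d /= d0 dX] : nbhs_ball L X by apply/nbhs_ballP; exact: open_nbhs_nbhs.
apply/cvgrPdist_le => e e0.
(* [X] is open around [L], so levels at distance [r] are available. *)
pose r := Num.min e (d / 2).
have r0 : 0 < r by rewrite lt_min e0/=; lra.
have re : r <= e by rewrite ge_min lexx.
have rd : r < d by rewrite gt_min; apply/orP; right; lra.
have XLr s : `|s| <= r -> X (L + s).
  move=> sr; apply: dX; rewrite /ball/= opprD addNKr normrN.
  exact: le_lt_trans rd.
have r_norm : `|r| <= r by rewrite gtr0_norm.
have up : \forall k \near \oo, forall i, x k i <= L + r.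
  by apply: eventually_lt; [exact: XLr | rewrite ltrDl].
have dn : \forall k \near \oo, forall i, L - r <= x k i.
  by apply: eventually_gt; [apply: XLr; rewrite normrN | rewrite gtrBl].
near=> k.
have xu : x k i <= L + r by apply: (near up k).
have xd : L - r <= x k i by apply: (near dn k).
by rewrite ler_distlC; apply/andP; split; lra.
Unshelve. all: by end_near. Qed.

End Equalizing.

(** * Pairwise Equalizing *)

(** If the two sides of a cut no longer met from some time on, no recurrent edge
    would cross it, and connectivity would put [b] on the side of [a]. *)
Lemma connected_cut_crossed (N : nat) (u : nat -> {set 'I_N}) :
  connected_graph (edges_infty u) ->
  forall (A : {set 'I_N}) a b, a \in A -> b \notin A ->
  forall K, exists2 k, (K <= k)%N &
    exists i j, [/\ i \in A, j \notin A, i \in u k.+1 & j \in u k.+1].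
Proof.
move=> conn A a b aA bA K; apply: contrapT => nocross.
have stay i j : [set i; j]%SET \in edges_infty u -> i \in A -> j \in A.
  move=> /set_mem Eij iA; apply/negPn/negP => jA; apply: Eij.
  apply: (sub_finite_set _ (finite_II K.+1)) => k /= [k1 uk].
  rewrite ltnNge; apply/negP => Kk; apply: nocross; exists k.-1.
    by rewrite -ltnS prednK.
  by exists i, j; rewrite prednK// uk !inE !eqxx ?orbT.
have cl : fingraph.closed [rel i j : 'I_N | [set i; j]%SET \in edges_infty u] A.
  move=> i j /= Eij; apply/idP/idP; first exact: stay.
  by apply: stay; rewrite finset.setUC.
by move: bA; rewrite -(closed_connect cl (conn a b)) aA.
Qed.

Lemma argmin_minimizer (R : realType) (X : set R) (g : R -> R) :
  minimizers X g !=set0 -> minimizers X g (argmin X g).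
Proof. by move=> [x gx]; exact: (xgetI 0 gx). Qed.

(** A preimage [z] is what makes the partial inverse in the algorithm select a
    point of [X] with the right sum. *)
Lemma PE_equalizes (R : realType) (X : set R) (N : nat) (f : 'I_N -> R -> R)
    (u : nat -> {set 'I_N}) (k : nat) (z : R) :
    X z ->
    \sum_(i in u k.+1) derive1 (f i) z =
      \sum_(i in u k.+1) derive1 (f i) (PE X f u k i) ->
  equalizes X (fun i => derive1 (f i)) (u k.+1) (PE X f u k) (PE X f u k.+1).
Proof.
move=> Xz zE; split; first by move=> i /negbTE /= ->.
pose h y := \sum_(i in u k.+1) derive1 (f i) y.
pose s := \sum_(i in u k.+1) derive1 (f i) (PE X f u k i).
have hs : (h @` X) s by exists z.
exists ('pinv_(fun=> 0) X h s); split.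
- have hX : set_surj X (h @` X) h by [].
  by apply: (surjpinv_image_sub hX (dflt := fun=> 0)); exists s.
- by move=> i /= ->.
- by have := pinvK (fun=> 0) (mem_set hs).
Qed.

(** Summing the strict tangent inequalities at [L] cancels the slopes. *)
Lemma argmin_total_objective (R : realType) (X : set R) (N : nat)
    (f : 'I_N -> R -> R) (L : R) (i0 : 'I_N) :
    is_interval X -> (forall i, strictly_convex_on X (f i)) ->
    (forall i z, X z -> derivable (f i) z 1) -> X L ->
    \sum_i derive1 (f i) L = 0 ->
  argmin X (total_objective f) = L.
Proof.
move=> Xi cf df XL gL0.
have Lmin y : X y -> L != y -> total_objective f L < total_objective f y.
  move=> Xy Ly.
  have tangent i : f i L + derive1 (f i) L * (y - L) < f i y.
    exact: strictly_convex_gt_tangent Xi (cf i) (df i L XL) XL Xy Ly.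
  have -> : total_objective f L =
      \sum_i (f i L + derive1 (f i) L * (y - L)).
    by rewrite big_split/= -mulr_suml gL0 mul0r addr0.
  rewrite /total_objective (bigD1 i0)//= [ltRHS](bigD1 i0)//=.
  by apply: ltr_leD => //; apply: ler_sum => i _; exact/ltW.
have [XA Amin] : minimizers X (total_objective f)
    (argmin X (total_objective f)).
  apply: argmin_minimizer; exists L; split=> // y Xy.
  by have [->|/(Lmin _ Xy)/ltW] := eqVneq L y.
apply/esym/eqP/negPn/negP => /(Lmin _ XA); rewrite ltNge.
by rewrite Amin.
Qed.

Theorem theorem1 (R : realType) (N : nat) (X : set R) (f : 'I_N -> R -> R)
    (E : nat -> {set {set 'I_N}}) (u : nat -> {set 'I_N})
    (hN : (2 <= N)%N)
    (hX0 : X !=set0) (hXopen : open X) (hXitv : is_interval X)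
    (hconvex : forall i, strictly_convex_on X (f i))
    (hC1 : forall i, continuously_differentiable_on X (f i))
    (hmin : forall i, minimizers X (f i) !=set0)
    (hE : forall k, (1 <= k)%N -> edge_set (E k))
    (hu : gossiping_pairs E u)
    (hconn : connected_graph (edges_infty u)) :
  V X f (PE X f u k) @[k --> \oo] --> (0 : R) /\
  forall i, PE X f u k i @[k --> \oo] --> argmin X (total_objective f).
Proof.
pose g i := derive1 (f i); pose x := PE X f u.
have i0 : 'I_N := Ordinal (ltnW hN).
have df i z : X z -> derivable (f i) z 1 by move=> Xz; apply: (hC1 i).1.
have g_lt i a b : X a -> X b -> a < b -> g i a < g i b.
  exact: strictly_convex_derive1_lt hXitv (hconvex i) (df i).
have gc i z : X z -> {for z, continuous (g i)}.
  have := (hC1 i).2; rewrite continuous_open_subspace// => gi Xz.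
  by apply: gi; exact: mem_set.
have x0_in i : X (x 0%N i) := (argmin_minimizer (hmin i)).1.
have balance0 : \sum_i g i (x 0%N i) = 0.
  rewrite big1// => i _; apply: (derive1_minimizer hXopen) => [z|].
    exact: df.
  exact: argmin_minimizer.
have step_in k : (forall i, X (x k i)) ->
    equalizes X g (u k.+1) (x k) (x k.+1).
  move=> Xx; have [_ card2] := hE k.+1 isT.
  have /card_gt0P[i iu] : (0 < #|u k.+1|)%N by rewrite card2//; exact: hu.
  have [z Xz zE] := common_value_exists hXitv g_lt iu Xx gc.
  exact: PE_equalizes zE.
have x_in k i : X (x k i).
  by elim: k i => [|k IH] //; apply: equalizes_in (IH) (step_in k IH).
have step k := step_in k (x_in k).
have [L XL LE] :=
  common_value_exists hXitv g_lt (finset.in_setT i0) x0_in gc.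
have {}LE : \sum_i g i L = \sum_i g i (x 0%N i).
  have inT i : (i \in [set: 'I_N]%SET) = true by rewrite inE.
  by move: LE; rewrite !(eq_bigl _ _ inT).
have argminE : argmin X (total_objective f) = L.
  by apply: (argmin_total_objective i0) => //; rewrite LE.
have x_cvg i : x k i @[k --> \oo] --> L.
  exact: (equalizing_cvg hXitv g_lt x0_in step
    (connected_cut_crossed hconn) hXopen XL LE).
split; last by rewrite argminE.
rewrite /V argminE.
have V0 : \sum_(i < N) (f i L - f i L - g i L * (L - L)) = 0.
  by rewrite big1// => i _; rewrite !subrr mulr0 subr0.
(* The first 0 is the neutral element of the sum in [V], the second the limit. *)
rewrite -{2}V0.
apply: cvg_big => [|i _]; first exact: add_continuous.
have fc : {for L, continuous (f i)}.
  by apply: differentiable_continuous; apply/derivable1_diffP; exact: df.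
apply: cvgB.
  apply: cvgB; first exact: cvg_cst.
  by apply: continuous_cvg (x_cvg i).
apply: cvgM.
  by apply: continuous_cvg (x_cvg i); exact: gc.
by apply: cvgB; [exact: cvg_cst|exact: x_cvg].
Qed.
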